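(* Let $n \geq 1$, let $Q\in\mathbb{R}^{n\times n}$ be a symmetric matrix, let $\alpha \in \mathbb{R}^n$ and $g\in\mathbb{R}$, and let $P = \{x \in \mathbb{R}^n \mid Ax \leq b\}$ be a polytope (a bounded polyhedron, given by finitely many linear inequalities). Let $$S = \{ x \in \mathbb{R}^n \mid x^{\top}Qx + \alpha^{\top} x = g,\ x \in P\}.$$ Then $\mathrm{conv}(S)$ is second-order cone representable.
   Context: $\mathrm{conv}(G)$ denotes the convex hull of $G \subseteq \mathbb{R}^n$. A set $C \subseteq \mathbb{R}^n$ is second-order cone representable (SOCr) in the standard sense if it is the projection onto the $x$-variables of a set of points $(x,u)\in\mathbb{R}^n\times\mathbb{R}^m$ (for some finite $m \ge 0$) defined by finitely many second-order cone constraints $\|D_k (x,u) + d_k\|_2 \leq e_k^{\top}(x,u) + f_k$, where $D_k$ are real matrices, $d_k, e_k$ are real vectors and $f_k$ are real numbers (linear inequalities and equations being special cases). *)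

(* Defs.v *)
From HB Require Import structures.
From mathcomp Require Import all_boot all_order all_algebra.
From mathcomp Require Import all_classical all_reals all_analysis.

Set Implicit Arguments.
Unset Strict Implicit.
Unset Printing Implicit Defensive.

Import Order.TTheory GRing.Theory Num.Theory.
Import numFieldNormedType.Exports.

Local Open Scope classical_set_scope.
Local Open Scope ring_scope.

(* R^n is 'cV[R]_n, with R an arbitrary realType. *)

Definition conv_hull (R : realType) (n : nat) (G : set 'cV[R]_n) : set 'cV[R]_n :=
  smallest (@convex_set R 'cV[R]_n) G.

(* The canonical norm on matrices is the max norm, so the Euclidean norm is
   defined here. *)
Definition norm2 (R : realType) (p : nat) (v : 'cV[R]_p) : R :=
  Num.sqrt (\sum_(i < p) v i ord0 ^+ 2).

Definition dotv (R : realType) (n : nat) (u v : 'cV[R]_n) : R :=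
  (u^T *m v) ord0 ord0.

(* The number of rows of D is part of the data: it may differ from one
   constraint to another. *)
Record soc_constraint (R : realType) (N : nat) := SocConstraint {
  soc_rows : nat;
  soc_D : 'M[R]_(soc_rows, N);
  soc_d : 'cV[R]_soc_rows;
  soc_e : 'cV[R]_N;
  soc_f : R }.

Definition soc_sat (R : realType) (N : nat) (c : soc_constraint R N)
    (z : 'cV[R]_N) : Prop :=
  norm2 (soc_D c *m z + soc_d c) <= dotv (soc_e c) z + soc_f c.

(* The point (x, u) of R^n x R^m is the stacked column col_mx x u. *)
Definition socr (R : realType) (n : nat) (C : set 'cV[R]_n) : Prop :=
  exists (m K : nat) (c : 'I_K -> soc_constraint R (n + m)),
    C = [set x | exists u : 'cV[R]_m, forall k : 'I_K,
                   soc_sat (c k) (col_mx x u)].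

Definition polyhedron (R : realType) (l n : nat) (A : 'M[R]_(l, n))
    (b : 'cV[R]_l) : set 'cV[R]_n :=
  [set x | forall i : 'I_l, (A *m x) i ord0 <= b i ord0].

(* Main.v *)
Require Import Defs.
From HB Require Import structures.
From mathcomp Require Import all_boot all_order all_algebra.
From mathcomp Require Import all_classical all_reals all_analysis.
From mathcomp Require Import ring lra.

Set Implicit Arguments.
Unset Strict Implicit.
Unset Printing Implicit Defensive.

Import Order.TTheory GRing.Theory Num.Theory.
Import numFieldNormedType.Exports.

Local Open Scope classical_set_scope.
Local Open Scope ring_scope.

(* For a quadratic function q and a convex P, conv {q = g} is the intersection of
   conv {q <= g} and conv {q >= g}: if q x < g, every segment from x to a point of
   {q >= g} crosses {q = g}.  So it suffices to treat conv {q <= g}, for arbitrary q,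
   by induction on the dimension.  Either every point x of {q = g} has a direction d,
   tangent to the quadric at x, along which q stays <= g; then the points of
   {q <= g} lie in the hull of those on the facets of P.  Or Q is positive definite
   on some tangent hyperplane; then {q <= g} is convex, or the union of two convex
   sets, and second-order cone representable.  Hulls of unions of bounded
   representable sets are representable by homogenization. *)

(** * Convexity and convex hulls *)

(* Unlike [convex_set], this form has a plain scalar weight. *)
Definition cvx (R : realType) (n : nat) (C : set 'cV[R]_n) : Prop :=
  forall x y t, 0 <= t <= 1 -> C x -> C y -> C (t *: x + (1 - t) *: y).

Lemma convex_setP (R : realType) (n : nat) (C : set 'cV[R]_n) :
  @convex_set R 'cV[R]_n C <-> cvx C.
Proof.
split=> [cC x y t /andP[t0 t1] Cx Cy|cC x y t].
  pose p : {i01 R} := Itv01 t0 t1.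
  by have /set_mem := cC x y p (mem_set Cx) (mem_set Cy).
move=> /set_mem Cx /set_mem Cy; apply/mem_set.
by apply: (cC x y t%:num) => //; apply/andP; split.
Qed.

Section ConvexHull.
Context {R : realType} {n : nat}.
Implicit Types (C G H : set 'cV[R]_n) (x y : 'cV[R]_n).

Lemma conv_hull_cvx G : cvx (conv_hull G).
Proof.
move=> x y t t01 Gx Gy C [cC GC].
by move/convex_setP: (cC) => /(_ x y t t01); apply; [apply: Gx|apply: Gy].
Qed.

Lemma sub_conv_hull G : G `<=` conv_hull G.
Proof. exact: sub_gen_smallest. Qed.

Lemma conv_hull_min G C : cvx C -> G `<=` C -> conv_hull G `<=` C.
Proof. by move=> /convex_setP cC; apply: smallest_sub. Qed.

Lemma conv_hull_id C : cvx C -> conv_hull C = C.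
Proof. by move=> /convex_setP; apply: smallest_id. Qed.

Lemma conv_hull_mono G H : G `<=` H -> conv_hull G `<=` conv_hull H.
Proof.
move=> GH; apply: conv_hull_min; first exact: conv_hull_cvx.
exact: subset_trans GH (@sub_conv_hull _).
Qed.

Lemma conv_hull_absorb G H :
  G `<=` H -> H `<=` conv_hull G -> conv_hull H = conv_hull G.
Proof.
move=> GH HG; apply/seteqP; split; last exact: conv_hull_mono.
exact: conv_hull_min (@conv_hull_cvx _) HG.
Qed.

Lemma cvx_opposite C x (d : 'cV[R]_n) (s t : R) : cvx C -> 0 <= s -> 0 <= t ->
  C (x + s *: d) -> C (x - t *: d) -> C x.
Proof.
move=> cC s0 t0 Cs Ct.
(* The case [s = 0] is set apart because the weight [t / (s + t)] used below has no meaning when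
   both steps vanish. *)
have [s_0|s_n0] := eqVneq s 0; first by move: Cs; rewrite s_0 scale0r addr0.
have st0 : 0 < s + t by rewrite ltr_pwDl// lt_neqAle eq_sym s_n0.
have := cC _ _ (t / (s + t)) _ Cs Ct.
have -> : t / (s + t) *: (x + s *: d) + (1 - t / (s + t)) *: (x - t *: d) = x.
  apply/matrixP => i j; rewrite !mxE; field; exact: lt0r_neq0.
apply; rewrite divr_ge0//= ?(ltW st0)// ler_pdivrMr// mul1r lerDr//.
Qed.

End ConvexHull.

(** * Inner product and Euclidean norm *)

Section DotProduct.
Context {R : realType}.

Lemma dotvE n (u v : 'cV[R]_n) : dotv u v = \sum_i u i 0 * v i 0.
Proof. by rewrite /dotv mxE; apply: eq_bigr => i _; rewrite mxE. Qed.

Lemma dotvC n (u v : 'cV[R]_n) : dotv u v = dotv v u.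
Proof. by rewrite !dotvE; apply: eq_bigr => i _; rewrite mulrC. Qed.

Lemma dotvDr n (u v w : 'cV[R]_n) : dotv u (v + w) = dotv u v + dotv u w.
Proof. by rewrite /dotv mulmxDr mxE. Qed.

Lemma dotvZr n (u v : 'cV[R]_n) a : dotv u (a *: v) = a * dotv u v.
Proof. by rewrite /dotv -scalemxAr mxE. Qed.

Lemma dotvDl n (u v w : 'cV[R]_n) : dotv (u + v) w = dotv u w + dotv v w.
Proof. by rewrite !(dotvC _ w) dotvDr. Qed.

Lemma dotvZl n (u v : 'cV[R]_n) a : dotv (a *: u) v = a * dotv u v.
Proof. by rewrite !(dotvC _ v) dotvZr. Qed.

Lemma dotv0r n (u : 'cV[R]_n) : dotv u 0 = 0.
Proof. by rewrite /dotv mulmx0 mxE. Qed.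

Lemma dotv0l n (u : 'cV[R]_n) : dotv 0 u = 0.
Proof. by rewrite dotvC dotv0r. Qed.

Lemma dotv_ge0 n (u : 'cV[R]_n) : 0 <= dotv u u.
Proof. by rewrite dotvE sumr_ge0// => i _; rewrite -expr2 sqr_ge0. Qed.

Lemma dotv_eq0 n (u : 'cV[R]_n) : dotv u u = 0 -> u = 0.
Proof.
rewrite dotvE => /eqP; rewrite psumr_eq0 => [/allP u0|i _]; last first.
  by rewrite -expr2 sqr_ge0.
apply/matrixP => i j; rewrite ord1 mxE; apply/eqP.
by have := u0 i (mem_index_enum i); rewrite /= mulf_eq0 orbb.
Qed.

Lemma dotv_mulmx p n (M : 'M[R]_(p, n)) u v : dotv u (M *m v) = dotv (M^T *m u) v.
Proof. by rewrite /dotv trmx_mul trmxK mulmxA. Qed.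

Lemma dotv_col p q (u1 v1 : 'cV[R]_p) (u2 v2 : 'cV[R]_q) :
  dotv (col_mx u1 u2) (col_mx v1 v2) = dotv u1 v1 + dotv u2 v2.
Proof. by rewrite /dotv tr_col_mx mul_row_col mxE. Qed.

Lemma dotv1 (u v : 'cV[R]_1) : dotv u v = u 0 0 * v 0 0.
Proof. by rewrite dotvE big_ord1. Qed.

Lemma norm2E n (v : 'cV[R]_n) : norm2 v = Num.sqrt (dotv v v).
Proof. by rewrite /norm2 dotvE; congr Num.sqrt; apply: eq_bigr => i _; rewrite expr2. Qed.

Lemma norm2_ge0 n (v : 'cV[R]_n) : 0 <= norm2 v.
Proof. exact: sqrtr_ge0. Qed.

Lemma norm2_le n (v : 'cV[R]_n) s :
  norm2 v <= s <-> 0 <= s /\ dotv v v <= s ^+ 2.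
Proof.
rewrite norm2E; split=> [vs|[s0 vs]].
  have s0 : 0 <= s by apply: le_trans vs; apply: sqrtr_ge0.
  split=> //; rewrite -(sqr_sqrtr (dotv_ge0 v)) lerXn2r// nnegrE sqrtr_ge0//.
by rewrite -(ger0_norm s0) -sqrtr_sqr ler_wsqrtr.
Qed.

Lemma norm2_le0 n (v : 'cV[R]_n) : norm2 v <= 0 <-> v = 0.
Proof.
rewrite norm2_le expr0n/=; split=> [[_ v0]|->]; last by rewrite dotv0r.
by apply: dotv_eq0; apply/eqP; rewrite eq_le v0 dotv_ge0.
Qed.

Lemma norm2Z n a (v : 'cV[R]_n) : 0 <= a -> norm2 (a *: v) = a * norm2 v.
Proof.
move=> a0; rewrite !norm2E dotvZl dotvZr mulrA -expr2 sqrtrM ?sqr_ge0//.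
by rewrite sqrtr_sqr ger0_norm.
Qed.

Lemma CauchySchwarz_dotv n (u v : 'cV[R]_n) : dotv u v <= norm2 u * norm2 v.
Proof.
have [u0|un0] := eqVneq u 0.
  by rewrite u0 dotv0l mulr_ge0// norm2_ge0.
set a := norm2 u; set b := norm2 v.
have a0 : 0 < a.
  by rewrite lt_neqAle norm2_ge0 andbT eq_sym; apply: contra_neqN un0 => /eqP a0;
    apply/norm2_le0; rewrite -/a a0.
have aa : dotv u u = a ^+ 2 by rewrite /a norm2E sqr_sqrtr ?dotv_ge0.
have bb : dotv v v = b ^+ 2 by rewrite /b norm2E sqr_sqrtr ?dotv_ge0.
(* With [a = |u|] and [b = |v|] this square expands to [2 a b (a b - u . v)], and [a b] is then
   cancelled. *)
have := dotv_ge0 (b *: u - a *: v).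
rewrite -scaleNr !(dotvDl, dotvDr, dotvZl, dotvZr) aa bb (dotvC v u) => h.
have [b0|bn0] := eqVneq b 0.
  have v0 : v = 0 by apply/norm2_le0; rewrite -/b b0.
  by rewrite v0 dotv0r b0 mulr0.
have b0 : 0 < b by rewrite lt_neqAle norm2_ge0 andbT eq_sym.
have ab0 : 0 < a * b by rewrite mulr_gt0.
rewrite -(ler_pM2l ab0); lra.
Qed.

Lemma ler_norm2D n (u v : 'cV[R]_n) : norm2 (u + v) <= norm2 u + norm2 v.
Proof.
apply/norm2_le; split; first by rewrite addr_ge0 ?norm2_ge0.
have aa w : dotv w w = norm2 (w : 'cV[R]_n) ^+ 2 by rewrite norm2E sqr_sqrtr ?dotv_ge0.
rewrite !(dotvDl, dotvDr) (dotvC v u) !aa; have := CauchySchwarz_dotv u v; lra.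
Qed.

End DotProduct.

(** * Affine maps *)

Definition affine (R : realType) (N p : nat) (h : 'cV[R]_N -> 'cV[R]_p) : Prop :=
  exists (M : 'M[R]_(p, N)) (v : 'cV[R]_p), forall z, h z = M *m z + v.

Section Affine.
Context {R : realType} {N : nat}.

Lemma affine_id : affine (fun z : 'cV[R]_N => z).
Proof. by exists 1%:M, 0 => z; rewrite mul1mx addr0. Qed.

Lemma affine_cst p (v : 'cV[R]_p) : affine (fun _ : 'cV[R]_N => v).
Proof. by exists 0, v => z; rewrite mul0mx add0r. Qed.

Lemma affineD p (h k : 'cV[R]_N -> 'cV[R]_p) :
  affine h -> affine k -> affine (fun z => h z + k z).
Proof.
move=> [M [v hE]] [M' [v' kE]]; exists (M + M'), (v + v') => z.
by rewrite hE kE mulmxDl addrACA.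
Qed.

Lemma affineM p q (h : 'cV[R]_N -> 'cV[R]_p) (M : 'M[R]_(q, p)) :
  affine h -> affine (fun z => M *m h z).
Proof.
move=> [M' [v hE]]; exists (M *m M'), (M *m v) => z.
by rewrite hE mulmxDr mulmxA.
Qed.

Lemma affineZ p (h : 'cV[R]_N -> 'cV[R]_p) a :
  affine h -> affine (fun z => a *: h z).
Proof.
move=> [M [v hE]]; exists (a *: M), (a *: v) => z.
by rewrite hE scalerDr scalemxAl.
Qed.

Lemma affineB p (h k : 'cV[R]_N -> 'cV[R]_p) :
  affine h -> affine k -> affine (fun z => h z - k z).
Proof.
move=> ah ak; under eq_fun do rewrite -scaleN1r.
by apply: affineD => //; apply: affineZ.
Qed.

Lemma affine_col p q (h : 'cV[R]_N -> 'cV[R]_p) (k : 'cV[R]_N -> 'cV[R]_q) :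
  affine h -> affine k -> affine (fun z => col_mx (h z) (k z)).
Proof.
move=> [M [v hE]] [M' [v' kE]]; exists (col_mx M M'), (col_mx v v') => z.
by rewrite hE kE mul_col_mx add_col_mx.
Qed.

Lemma affine_usub p q (h : 'cV[R]_N -> 'cV[R]_(p + q)) :
  affine h -> affine (fun z => usubmx (h z)).
Proof.
move=> [M [v hE]]; exists (usubmx M), (usubmx v) => z.
rewrite hE -{1}(vsubmxK M) mul_col_mx -{1}(vsubmxK v) add_col_mx.
by rewrite col_mxKu.
Qed.

Lemma affine_dsub p q (h : 'cV[R]_N -> 'cV[R]_(p + q)) :
  affine h -> affine (fun z => dsubmx (h z)).
Proof.
move=> [M [v hE]]; exists (dsubmx M), (dsubmx v) => z.
rewrite hE -{1}(vsubmxK M) mul_col_mx -{1}(vsubmxK v) add_col_mx.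
by rewrite col_mxKd.
Qed.

End Affine.

(** * Sets cut out by second-order cone constraints, before any projection *)

Definition socset (R : realType) (N : nat) (Z : set 'cV[R]_N) : Prop :=
  exists (K : nat) (c : 'I_K -> soc_constraint R N),
    Z = [set z | forall k, soc_sat (c k) z].

Section SocSet.
Context {R : realType} {N : nat}.

Lemma socset_soc p (h : 'cV[R]_N -> 'cV[R]_p) (k : 'cV[R]_N -> 'cV[R]_1) :
  affine h -> affine k -> socset [set z | norm2 (h z) <= k z 0 0].
Proof.
move=> [M [v hE]] [e [f kE]].
exists 1, (fun=> SocConstraint M v e^T (f 0 0)); apply/seteqP.
have eqs z : soc_sat (SocConstraint M v e^T (f 0 0)) z = (norm2 (h z) <= k z 0 0).
  by rewrite /soc_sat/= hE kE mxE /dotv trmxK.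
by split=> z /=; [move=> h0 _; rewrite eqs|move=> /(_ 0); rewrite eqs].
Qed.

Lemma socsetT : socset (@setT 'cV[R]_N).
Proof.
exists 0, (fun=> SocConstraint (0 : 'M[R]_(0, N)) 0 0 0).
by apply/seteqP; split=> z // _ [].
Qed.

Lemma socsetI (Z W : set 'cV[R]_N) : socset Z -> socset W -> socset (Z `&` W).
Proof.
move=> [K [c ->]] [L [d ->]].
exists (K + L), (fun i => match fintype.split i with inl j => c j | inr j => d j end).
apply/seteqP; split=> z /= => [[cz dz] i|cdz]; first by case: fintype.split.
split=> i; first by have := cdz (unsplit (inl i)); rewrite unsplitK.
by have := cdz (unsplit (inr i)); rewrite unsplitK.
Qed.

Lemma socset_ge0 (h : 'cV[R]_N -> 'cV[R]_1) :
  affine h -> socset [set z | 0 <= h z 0 0].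
Proof.
(* A cone constraint whose left-hand vector has no rows is a linear inequality. *)
move=> ah; have := socset_soc (affine_cst (0 : 'cV[R]_0)) ah.
by under eq_set do rewrite norm2E dotv0l sqrtr0.
Qed.

Lemma socset_eq0 p (h : 'cV[R]_N -> 'cV[R]_p) :
  affine h -> socset [set z | h z = 0].
Proof.
move=> ah; have := socset_soc ah (affine_cst 0).
by under eq_set do rewrite mxE (propext (norm2_le0 _)).
Qed.

Lemma socset_preimage M (h : 'cV[R]_N -> 'cV[R]_M) (Z : set 'cV[R]_M) :
  affine h -> socset Z -> socset [set z | Z (h z)].
Proof.
move=> [H [v hE]] [K [c ->]].
exists K, (fun k => SocConstraint (soc_D (c k) *m H) (soc_D (c k) *m v + soc_d (c k))
  (H^T *m soc_e (c k)) (dotv (soc_e (c k)) v + soc_f (c k))).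
apply: eq_set => z; apply: eq_forall => k; rewrite /soc_sat/= hE.
by rewrite mulmxDr mulmxA -[X in norm2 X]addrA dotvDr dotv_mulmx -addrA.
Qed.

End SocSet.

(** * Homogenization *)

Definition cone (R : realType) (N : nat) (W : set 'cV[R]_N) : Prop :=
  [/\ W 0, forall w w', W w -> W w' -> W (w + w')
    & forall t w, 0 <= t -> W w -> W (t *: w)].

(** The extra coordinate [s] multiplies the constant terms, turning each constraint into
    [|D z + s d| <= e . z + s f]. This is positively homogeneous, and stable under sums by the
    triangle inequality; at [s = 1] it is the original constraint. *)
Lemma soc_homogenize (R : realType) (N : nat) (Z : set 'cV[R]_N) : socset Z ->
  exists W : set 'cV[R]_(N + 1),
    [/\ socset W, cone W & forall z, W (col_mx z 1) <-> Z z].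
Proof.
move=> [K [c ->]].
pose c' k := SocConstraint (row_mx (soc_D (c k)) (soc_d (c k))) 0
  (col_mx (soc_e (c k)) (soc_f (c k))%:M) 0.
have satE k w : soc_sat (c' k) w <-> norm2 (soc_D (c' k) *m w) <= dotv (soc_e (c' k)) w.
  by rewrite /soc_sat [soc_d _]/= [soc_f _]/= !addr0.
exists [set w | forall k, soc_sat (c' k) w]; split.
- by exists K, c'.
- split=> [k|w w' Ww Ww' k|t w t0 Ww k]; apply/satE.
  + by rewrite mulmx0 dotv0r norm2E dotv0l sqrtr0.
  + rewrite mulmxDr dotvDr; apply: le_trans (ler_norm2D _ _) _.
    by rewrite lerD//; apply/satE.
  + by rewrite -scalemxAr norm2Z// dotvZr ler_wpM2l//; apply/satE.
- move=> z; split=> Wz k; have := Wz k; rewrite /soc_sat/= addr0 mul_row_col mulmx1;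
    by rewrite dotv_col dotv1 !mxE eqxx mulr1n mulr1 addr0.
Qed.

(** * Closure properties of representable sets *)

Section Socr.
Context {R : realType} {n : nat}.
Implicit Types C : set 'cV[R]_n.

(** The graph [x = h z] with [z] in [Z] is given by cone constraints, and [z] serves as the
    auxiliary variable. *)
Lemma socr_image N (Z : set 'cV[R]_N) (h : 'cV[R]_N -> 'cV[R]_n) :
  socset Z -> affine h -> socr [set h z | z in Z].
Proof.
move=> sZ ah.
have sW : socset [set w : 'cV[R]_(n + N) |
    Z (dsubmx w) /\ usubmx w - h (dsubmx w) = 0].
  apply: (@socsetI _ _ [set w | Z (dsubmx w)]).
    exact: socset_preimage (affine_dsub affine_id) sZ.
  apply: socset_eq0; apply: affineB (affine_usub affine_id) _.
  have [M [v hE]] := ah.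
  under eq_fun do rewrite hE.
  exact: affineD (affineM _ (affine_dsub affine_id)) (affine_cst _).
have [K [c WE]] := sW; exists N, K, c.
apply/seteqP; split=> x /= [u].
  move=> Zu <-; exists u.
  have : [set w | forall k, soc_sat (c k) w] (col_mx (h u) u).
    by rewrite -WE /= col_mxKu col_mxKd subrr.
  by [].
move=> cu; exists u.
  have : [set w | forall k, soc_sat (c k) w] (col_mx x u) by [].
  by rewrite -WE /= col_mxKd => -[].
have : [set w | forall k, soc_sat (c k) w] (col_mx x u) by [].
by rewrite -WE /= col_mxKu col_mxKd => -[_ /eqP]; rewrite subr_eq0 => /eqP.
Qed.

Lemma socr_soc Z : socset Z -> @socr R n Z.
Proof.
move=> sZ; have := socr_image sZ affine_id.
by rewrite image_id.
Qed.

Lemma socr_lift C : socr C -> exists (m : nat) (Z : set 'cV[R]_(n + m)),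
  socset Z /\ C = [set usubmx z | z in Z].
Proof.
move=> [m [K [c ->]]]; exists m, [set z | forall k, soc_sat (c k) z].
split; first by exists K, c.
apply/seteqP; split=> x /=; first by move=> [u cu]; exists (col_mx x u); rewrite ?col_mxKu.
by move=> [z cz <-]; exists (dsubmx z); rewrite vsubmxK.
Qed.

Lemma socr0 : socr (@set0 'cV[R]_n).
Proof.
apply: socr_soc; have := socset_ge0 (affine_cst (N := n) (-1 : 'cV[R]_1)).
have -> // : [set z : 'cV[R]_n | 0 <= (-1 : 'cV[R]_1) 0 0] = set0.
by apply/seteqP; split=> z //=; rewrite !mxE oppr_ge0 lt_geF.
Qed.

(** Convex combinations of lifted points are sums inside the homogenizing cone, taken at height
    one. *)
Lemma socr_cvx C : socr C -> cvx C.
Proof.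
move=> /socr_lift[m [Z [/soc_homogenize[W [_ [_ WD WZ] ZE]] ->]]].
move=> _ _ t /andP[t0 t1] [x Zx <-] [y Zy <-].
exists (t *: x + (1 - t) *: y); last first.
  by apply/matrixP => i j; rewrite !mxE.
apply/ZE; have -> : col_mx (t *: x + (1 - t) *: y) 1 =
    t *: col_mx x 1 + (1 - t) *: col_mx y 1 :> 'cV[R]_(n + m + 1).
  rewrite !scale_col_mx add_col_mx; congr col_mx.
  by rewrite -scalerDl addrC subrK scale1r.
by apply: WD; apply: WZ; rewrite ?subr_ge0//; apply/ZE.
Qed.

(** Both lifts are placed side by side, with a linear equation forcing their visible parts to
    agree. *)
Lemma socrI C D : socr C -> socr D -> socr (C `&` D).
Proof.
move=> /socr_lift[m [Z [sZ ->]]] /socr_lift[k [Y [sY ->]]].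
have -> : [set usubmx z | z in Z] `&` [set usubmx z | z in Y] =
    [set usubmx (usubmx w) | w in
      [set w : 'cV[R]_((n + m) + (n + k)) | Z (usubmx w) /\
        (Y (dsubmx w) /\ usubmx (usubmx w) - usubmx (dsubmx w) = 0)]].
  apply/seteqP; split=> x /=.
    move=> [[z Zz <-] [y Yy yz]]; exists (col_mx z y); rewrite !col_mxKu// col_mxKd.
    by rewrite yz subrr.
  move=> [w [Zw [Yw /eqP]]]; rewrite subr_eq0 => /eqP e <-.
  by split; [exists (usubmx w)|exists (dsubmx w)].
apply: socr_image; last by do 2!apply: affine_usub; exact: affine_id.
apply: (@socsetI _ _ [set w | Z (usubmx w)]).
  by apply: socset_preimage sZ; apply: affine_usub affine_id.
apply: (@socsetI _ _ [set w | Y (dsubmx w)]).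
  by apply: socset_preimage sY; apply: affine_dsub affine_id.
apply: socset_eq0; apply: affineB; apply: affine_usub.
  exact: affine_usub affine_id.
exact: affine_dsub affine_id.
Qed.

End Socr.

Lemma socr_affine_image (R : realType) (n p : nat) (h : 'cV[R]_n -> 'cV[R]_p)
  (C : set 'cV[R]_n) : affine h -> socr C -> socr [set h x | x in C].
Proof.
move=> [M [v hE]] /socr_lift[m [Z [sZ ->]]].
rewrite image_comp; apply: socr_image sZ _.
exists (M *m row_mx 1%:M 0), v => z /=.
by rewrite hE -mulmxA -{2}(vsubmxK z) mul_row_col mul1mx mul0mx addr0.
Qed.

(** Affine maps preserve convex combinations, so both images and preimages of convex sets are
    convex; each gives one inclusion. *)
Lemma conv_hull_affine (R : realType) (n p : nat) (h : 'cV[R]_n -> 'cV[R]_p)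
    (G : set 'cV[R]_n) : affine h ->
  conv_hull [set h x | x in G] = [set h x | x in conv_hull G].
Proof.
move=> [M [v hE]].
have hcvx x y t : h (t *: x + (1 - t) *: y) = t *: h x + (1 - t) *: h y.
  rewrite !hE mulmxDr -!scalemxAr.
  by apply/matrixP => i j; rewrite !mxE; ring.
apply/seteqP; split.
  apply: conv_hull_min => [|_ [x Gx <-]]; last by exists x => //; exact: sub_conv_hull.
  move=> _ _ t t01 [x Gx <-] [y Gy <-]; exists (t *: x + (1 - t) *: y) => //.
  exact: conv_hull_cvx.
suff : conv_hull G `<=` [set x | conv_hull [set h x | x in G] (h x)].
  by move=> GG _ [x /GG Gx <-].
apply: conv_hull_min => [x y t t01 Gx Gy /=|x Gx /=].
  by rewrite hcvx; apply: conv_hull_cvx.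
by apply: sub_conv_hull; exists x.
Qed.

(** * Bounded sets *)

(** A bound on coordinates passes at once to a facet parametrized by all coordinates but one. *)
Definition entry_bounded (R : realType) (n : nat) (B : set 'cV[R]_n) : Prop :=
  exists M, forall x, B x -> forall i, `|x i 0| <= M.

Section Bounded.
Context {R : realType} {n : nat}.
Implicit Types B C : set 'cV[R]_n.

Lemma bounded_set_entry B : bounded_set B -> entry_bounded B.
Proof.
(* [MB] bounds the norm only by numbers strictly above [M], hence [M + 1]. *)
move=> [M [_ MB]]; exists (M + 1) => x Bx i.
apply: le_trans (MB _ _ _ Bx); last by rewrite ltrDl.
rewrite /Num.Def.normr/= mx_normrE.
exact: (@le_bigmax_cond _ _ _ 0 (i, 0) xpredT (fun ij : 'I_n * 'I_1 => `|x ij.1 ij.2|)).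
Qed.

Lemma entry_bounded_sub B C : B `<=` C -> entry_bounded C -> entry_bounded B.
Proof. by move=> BC [M CM]; exists M => x /BC /CM. Qed.

Lemma entry_bounded_ray B x (d : 'cV[R]_n) : entry_bounded B ->
  (forall t, 0 <= t -> B (x + t *: d)) -> d = 0.
Proof.
move=> [M BM] Bd; apply/matrixP => i j; rewrite ord1 [RHS]mxE.
apply/eqP/contraT => di0.
have d0 : 0 < `|d i 0| by rewrite normr_gt0.
have M0 : 0 <= M by apply: le_trans (BM _ (Bd 0 _) i).
(* At this [t] the displacement in coordinate [i] has size [M + |x i| + 1], more than the
   [M + |x i|] that the bound permits. *)
pose t := (M + `|x i 0| + 1) / `|d i 0|.
have t0 : 0 <= t by rewrite divr_ge0// ?addr_ge0.
have := BM _ (Bd t t0) i; rewrite !mxE => xM.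
have : `|t * d i 0| <= M + `|x i 0|.
  have -> : t * d i 0 = (x i 0 + t * d i 0) - x i 0 by ring.
  by apply: le_trans (ler_normB _ _) _; rewrite lerD2r.
rewrite normrM (ger0_norm t0) /t divfK ?lt0r_neq0//; lra.
Qed.

End Bounded.

(** * Hulls of finite unions *)

Section HullUnion.
Context {R : realType} {n : nat}.
Implicit Types C D G B : set 'cV[R]_n.

(** [C] becomes a linear image of the height-one slice of a cone: [M] discards the auxiliary
    variables and the height. *)
Lemma socr_cone C : socr C -> exists (N : nat) (W : set 'cV[R]_(N + 1)) (M : 'M[R]_(n, N + 1)),
  [/\ socset W, cone W & C = [set M *m col_mx z 1 | z in [set z | W (col_mx z 1)]]].
Proof.
move=> /socr_lift[m [Z [/soc_homogenize[W [sW cW WZ]] ->]]].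
have ME (z : 'cV[R]_(n + m)) :
    row_mx (row_mx 1%:M 0) 0 *m col_mx z (1 : 'cV[R]_1) = usubmx z.
  by rewrite mul_row_col mul0mx addr0 -{1}(vsubmxK z) mul_row_col mul0mx mul1mx addr0.
exists (n + m)%N, W, (row_mx (row_mx 1%:M 0) 0); split=> //.
by apply/seteqP; split=> _ /= [z /WZ Zz <-]; exists z; rewrite ?ME.
Qed.

(* At height zero the point [w] is a recession direction of [C], so that
   boundedness forces [M *m w] to vanish. *)
Lemma cone_section N (W : set 'cV[R]_(N + 1)) (M : 'M[R]_(n, N + 1)) C w :
  cone W -> C = [set M *m col_mx z 1 | z in [set z | W (col_mx z 1)]] ->
  entry_bounded C -> C !=set0 -> W w -> 0 <= dsubmx w 0 0 ->
  exists2 y, C y & M *m w = dsubmx w 0 0 *: y.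
Proof.
move=> [W0 WD WZ] CE bC C0 Ww.
have [z0 Wz0] : exists z0, W (col_mx z0 1).
  by case: C0 => y; rewrite CE => -[z0 Wz0 _]; exists z0.
rewrite le_eqVlt => /predU1P[w0|w_gt0].
  have dw0 : dsubmx w = 0 by apply/matrixP => i j; rewrite !ord1 -w0 mxE.
  exists (M *m col_mx z0 1); first by rewrite CE; exists z0.
  rewrite -w0 scale0r; apply: (entry_bounded_ray (x := M *m col_mx z0 1) bC) => t t0.
  rewrite CE; exists (z0 + t *: usubmx w) => /=.
    have -> : col_mx (z0 + t *: usubmx w) 1 = col_mx z0 1 + t *: w :> 'cV[R]_(N + 1).
      by rewrite -{2}(vsubmxK w) dw0 scale_col_mx scaler0 add_col_mx addr0.
    by apply: WD => //; apply: WZ.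
  rewrite scalemxAr -mulmxDr -{2}(vsubmxK w) dw0 scale_col_mx scaler0 add_col_mx.
  by rewrite addr0.
have wE : w = dsubmx w 0 0 *: col_mx ((dsubmx w 0 0)^-1 *: usubmx w) 1.
  rewrite -{1}(vsubmxK w) scale_col_mx scalerA divff ?lt0r_neq0// scale1r.
  by congr col_mx; apply/matrixP => i j; rewrite !ord1 !mxE eqxx mulr1.
exists (M *m col_mx ((dsubmx w 0 0)^-1 *: usubmx w) 1).
  rewrite CE; exists ((dsubmx w 0 0)^-1 *: usubmx w) => //=.
  have -> : col_mx ((dsubmx w 0 0)^-1 *: usubmx w) 1 = (dsubmx w 0 0)^-1 *: w.
    by rewrite [X in _ = _ *: X]wE scalerA mulVf ?lt0r_neq0// scale1r.
  by apply: WZ => //; rewrite invr_ge0 ltW.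
by rewrite [X in _ *m X = _]wE scalemxAr.
Qed.

(** The hull is the set of sums of one point from each homogenizing cone, with nonnegative heights
    adding up to one. Empty sets are set aside first, since [cone_section] asks for a point of the
    set. *)
Lemma socr_hullU C D : entry_bounded C -> entry_bounded D -> socr C -> socr D ->
  socr (conv_hull (C `|` D)).
Proof.
move=> bC bD sC sD.
have [->|/set0P C0] := eqVneq C set0.
  by rewrite set0U conv_hull_id//; exact: socr_cvx.
have [->|/set0P D0] := eqVneq D set0.
  by rewrite setU0 conv_hull_id//; exact: socr_cvx.
have [N1 [W1 [M1 [sW1 cW1 CE]]]] := socr_cone sC.
have [N2 [W2 [M2 [sW2 cW2 DE]]]] := socr_cone sD.
pose Z := [set w : 'cV[R]_((N1 + 1) + (N2 + 1)) | W1 (usubmx w) /\ (W2 (dsubmx w) /\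
  (0 <= dsubmx (usubmx w) 0 0 /\ (0 <= dsubmx (dsubmx w) 0 0 /\
   dsubmx (usubmx w) + dsubmx (dsubmx w) - 1 = 0)))].
pose h (w : 'cV[R]_((N1 + 1) + (N2 + 1))) := M1 *m usubmx w + M2 *m dsubmx w.
have au : affine (fun w : 'cV[R]_((N1 + 1) + (N2 + 1)) => usubmx w).
  exact: affine_usub affine_id.
have ad : affine (fun w : 'cV[R]_((N1 + 1) + (N2 + 1)) => dsubmx w).
  exact: affine_dsub affine_id.
have sZ : socset Z.
  apply: (@socsetI _ _ [set w | W1 (usubmx w)]); first exact: socset_preimage.
  apply: (@socsetI _ _ [set w | W2 (dsubmx w)]); first exact: socset_preimage.
  apply: socsetI; first by apply: socset_ge0; apply: affine_dsub.
  apply: socsetI; first by apply: socset_ge0; apply: affine_dsub.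
  apply: socset_eq0; apply: affineB (affine_cst _).
  by apply: affineD; apply: affine_dsub.
suff -> : conv_hull (C `|` D) = [set h w | w in Z].
  by apply: socr_image => //; apply: affineD; apply: affineM.
apply/seteqP; split.
  apply: conv_hull_min => [|x [|]].
  - have [_ W1D W1Z] := cW1; have [_ W2D W2Z] := cW2.
    move=> _ _ t /andP[t0 t1] [x [x1 [x2 [x3 [x4 x5]]]] <-] [y [y1 [y2 [y3 [y4 y5]]]] <-].
    have s0 : 0 <= 1 - t by rewrite subr_ge0.
    exists (t *: x + (1 - t) *: y); last first.
      by rewrite /h !linearD/= !linearZ/= addrACA.
    rewrite /Z/= !linearD/= !linearZ/=; split; first by apply: W1D; [apply: W1Z|apply: W1Z].
    split; first by apply: W2D; [apply: W2Z|apply: W2Z].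
    move/eqP : x5; rewrite subr_eq0 => /eqP/(congr1 (fun M : 'M[R]_1 => M 0 0)).
    move/eqP : y5; rewrite subr_eq0 => /eqP/(congr1 (fun M : 'M[R]_1 => M 0 0)).
    rewrite !mxE/= in x3 x4 y3 y4 * => y5 x5.
    split; first by rewrite addr_ge0 ?mulr_ge0.
    split; first by rewrite addr_ge0 ?mulr_ge0.
    apply/matrixP => i j; rewrite !ord1 !mxE.
    set a := x _ _ in x5 *; set b := x _ _ in x5 *.
    set c := y _ _ in y5 *; set d := y _ _ in y5 *.
    have -> : a = 1 - b by rewrite -[RHS]opprK opprB -[X in b - X]x5; ring.
    have -> : c = 1 - d by rewrite -[RHS]opprK opprB -[X in d - X]y5; ring.
    rewrite eqxx mulr1n; ring.
  - rewrite CE => -[z Wz <-]; exists (col_mx (col_mx z 1) 0); last first.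
      by rewrite /h col_mxKu col_mxKd mulmx0 addr0.
    have [W20 _ _] := cW2.
    rewrite /Z/= !col_mxKu !col_mxKd linear0 addr0 subrr mxE; do ?split => //.
    by rewrite !mxE.
  - rewrite DE => -[z Wz <-]; exists (col_mx 0 (col_mx z 1)); last first.
      by rewrite /h col_mxKu col_mxKd mulmx0 add0r.
    have [W10 _ _] := cW1.
    rewrite /Z/= !col_mxKu !col_mxKd linear0 add0r subrr !mxE; do ?split => //.
move=> _ [w [w1 [w2 [w3 [w4 w5]]]] <-].
(* The two heights become the weights of a convex combination of a point of [C] and a point of
   [D]. *)
have [y Cy yE] := cone_section cW1 CE bC C0 w1 w3.
have [y' Dy yE'] := cone_section cW2 DE bD D0 w2 w4.
rewrite /h yE yE'.
move/eqP : w5; rewrite subr_eq0 => /eqP/(congr1 (fun M : 'M[R]_1 => M 0 0)).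
rewrite mxE [RHS]mxE eqxx => w5.
have -> : dsubmx (dsubmx w) 0 0 = 1 - dsubmx (usubmx w) 0 0 by rewrite -[1]w5; ring.
apply: conv_hull_cvx.
- by rewrite w3/= -[leRHS]w5 lerDl.
- by apply: sub_conv_hull; left.
- by apply: sub_conv_hull; right.
Qed.

(** Induction on the list, adding one hull at a time; the common convex bounded superset [B] keeps
    all intermediate hulls bounded. *)
Lemma socr_hull_finU (I : eqType) (s : seq I) (G : I -> set 'cV[R]_n) B :
  cvx B -> entry_bounded B -> (forall i, G i `<=` B) ->
  (forall i, socr (conv_hull (G i))) ->
  socr (conv_hull [set x | exists2 i, i \in s & G i x]).
Proof.
move=> cB bB GB sG; elim: s => [|i s IHs].
  have -> : [set x | exists2 i, i \in [::] & G i x] = set0.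
    by apply/seteqP; split=> // x [].
  by rewrite conv_hull_id; [exact: socr0|move=> x y t _ []].
set U := [set x | exists2 j, j \in s & G j x] in IHs *.
set V := [set x | _].
have -> : conv_hull V = conv_hull (conv_hull (G i) `|` conv_hull U).
  apply/esym/conv_hull_absorb => [x [j]|].
    rewrite inE => /predU1P[->|js] Gx; first by left; exact: sub_conv_hull.
    by right; apply: sub_conv_hull; exists j.
  rewrite subUset; split; apply: conv_hull_mono => x.
    by move=> Gx; exists i => //; rewrite mem_head.
  by move=> [j js Gx]; exists j => //; rewrite inE js orbT.
apply: socr_hullU => //; apply: entry_bounded_sub bB; apply: conv_hull_min => //.
by move=> x [j _ /GB].
Qed.

End HullUnion.

(** * Factorization of quadratic forms *)

Section QuadraticForm.
Context {R : realType}.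

Lemma dotv_sym n (Q : 'M[R]_n) (x y : 'cV[R]_n) :
  Q^T = Q -> dotv x (Q *m y) = dotv y (Q *m x).
Proof. by move=> hQ; rewrite dotv_mulmx hQ dotvC. Qed.

(** Cholesky factorization by induction on the dimension. A zero corner entry [a] forces its column
    [v] to vanish; otherwise the square in the first variable is completed, and the Schur complement
    [S = B - v v^T / a] is again positive semidefinite. *)
Lemma psd_factor n (Q : 'M[R]_n) : Q^T = Q -> (forall d, 0 <= dotv d (Q *m d)) ->
  exists p (L : 'M[R]_(p, n)), forall d, dotv d (Q *m d) = dotv (L *m d) (L *m d).
Proof.
elim: n Q => [|n IHn] Q hQ psdQ.
  by exists 0, 0 => d; rewrite mul0mx (flatmx0 d) dotv0l dotv0l.
pose Q' : 'M[R]_(1 + n) := Q.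
pose a := Q' 0 0; pose v := dlsubmx Q'; pose B := drsubmx Q'.
have hQ' : Q'^T = Q' by [].
have Qb : Q' = block_mx a%:M v^T v B.
  rewrite -[LHS]submxK; congr block_mx.
    by apply/matrixP => i j; rewrite !ord1 !mxE eqxx mulr1n /a;
      congr (Q' _ _); apply/val_inj.
  by rewrite /v trmx_dlsub hQ'.
have hB : B^T = B by rewrite /B trmx_drsub hQ'.
have QE (s : R) (w : 'cV[R]_n) : dotv (col_mx s%:M w) (Q' *m col_mx s%:M w) =
    a * s ^+ 2 + 2 * s * dotv v w + dotv w (B *m w).
  rewrite Qb mul_block_col dotv_col dotv1 !mul_mx_scalar.
  rewrite dotvDr dotvZr (dotvC w v) [(_ + v^T *m w) 0 0]mxE -/(dotv v w).
  rewrite !mxE eqxx !mulr1n.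
  ring.
have colE (d : 'cV[R]_(1 + n)) : d = col_mx (d 0 0)%:M (dsubmx d).
  rewrite -[LHS]vsubmxK; congr col_mx; apply/matrixP => i j.
  by rewrite !ord1 !mxE eqxx mulr1n; congr (d _ _); apply/val_inj.
have psdE (s : R) w : 0 <= a * s ^+ 2 + 2 * s * dotv v w + dotv w (B *m w).
  by rewrite -QE; apply: psdQ.
have a0 : 0 <= a.
  by have := psdE 1 0; rewrite dotv0r dotv0l expr1n mulr1 mulr0 !addr0.
have [a_0|an0] := eqVneq a 0.
  have v0 : v = 0.
    apply: dotv_eq0; apply/eqP/contraT => k0.
    (* With this first coordinate the form would take the value [-1]. *)
    have := psdE (- (dotv v (B *m v) + 1) / (2 * dotv v v)) v; rewrite a_0 mul0r add0r.
    have -> : 2 * (- (dotv v (B *m v) + 1) / (2 * dotv v v)) * dotv v v =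
      - (dotv v (B *m v) + 1) by field.
    lra.
  have psdB w : 0 <= dotv w (B *m w).
    by have := psdE 0 w; rewrite a_0 mul0r mulr0 mul0r !add0r.
  have [p [L LE]] := IHn B hB psdB.
  pose T : 'M[R]_(p, 1 + n) := row_mx 0 L; exists p, T => d.
  change (dotv d (Q' *m d) = dotv (T *m d) (T *m d)).
  rewrite (colE d) QE a_0 v0 dotv0l mul_row_col mul0mx !add0r LE.
  by rewrite mul0r mulr0 !add0r.
have a_gt0 : 0 < a by rewrite lt_neqAle eq_sym an0.
pose S := B - a^-1 *: (v *m v^T).
have hS : S^T = S.
  by rewrite /S linearB/= linearZ/= trmx_mul trmxK hB.
have SE w : dotv w (S *m w) = dotv w (B *m w) - a^-1 * (dotv v w) ^+ 2.
  rewrite mulmxBl dotvDr -scaleN1r dotvZr -scalemxAl dotvZr -mulmxA.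
  rewrite (dotv_mulmx v) dotv1.
  have -> : (v^T *m w) 0 0 = dotv v w by [].
  ring.
have psdS w : 0 <= dotv w (S *m w).
  (* This first coordinate minimizes the form for fixed [w], and the minimum is the Schur complement
     at [w]. *)
  rewrite SE; have := psdE (- a^-1 * dotv v w) w.
  have -> : a * (- a^-1 * dotv v w) ^+ 2 + 2 * (- a^-1 * dotv v w) * dotv v w =
    - (a^-1 * dotv v w ^+ 2) by field.
  lra.
have [p [L LE]] := IHn S hS psdS.
pose r := Num.sqrt a.
have r0 : r != 0 by rewrite lt0r_neq0// sqrtr_gt0.
have rr : r ^+ 2 = a by rewrite sqr_sqrtr.
pose T : 'M[R]_(1 + p, 1 + n) := col_mx (row_mx r%:M (r^-1 *: v^T)) (row_mx 0 L).
exists (1 + p)%N, T => d.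
change (dotv d (Q' *m d) = dotv (T *m d) (T *m d)).
rewrite (colE d); set x := _ 0 0; set w := dsubmx _.
rewrite QE mul_col_mx dotv_col !mul_row_col mul0mx add0r -LE SE dotv1.
rewrite mul_scalar_mx -scalemxAl !mxE eqxx mulr1n.
have -> : \sum_j v^T 0 j * w j 0 = dotv v w by rewrite /dotv mxE.
by rewrite -rr; field.
Qed.

(* The bordered matrix [Q, c; c^T, 0] is invertible, and it provides a vector [e]
   with [dotv c e = 1] that is Q-orthogonal to the kernel of [c]. *)
Lemma hyperplane_pd_factor n (Q : 'M[R]_n) (c : 'cV[R]_n) : Q^T = Q ->
  (forall d, d != 0 -> dotv c d = 0 -> 0 < dotv d (Q *m d)) ->
  exists a p (L : 'M[R]_(p, n)), forall d,
    dotv d (Q *m d) = dotv (L *m d) (L *m d) + a * dotv c d ^+ 2.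
Proof.
move=> hQ pdQ.
have psdQ d : dotv c d = 0 -> 0 <= dotv d (Q *m d).
  by have [->|d0 cd] := eqVneq d 0; [rewrite dotv0l|apply/ltW/pdQ].
have [c0|cn0] := eqVneq c 0.
  have [d|p [L LE]] := psd_factor hQ; first by apply: psdQ; rewrite c0 dotv0l.
  by exists 0, p, L => d; rewrite mul0r addr0.
pose M : 'M[R]_(n + 1) := block_mx Q c c^T 0.
have hM : M^T = M by rewrite /M tr_block_mx hQ trmxK trmx0.
have Munit : M \in unitmx.
  (* A kernel vector [(d, s)] satisfies [Q d = - s c] and [c . d = 0], so [d . Q d = 0]. Hence
     [d = 0] by positivity, then [s c = 0], and [s = 0] because [c] is nonzero. *)
  rewrite -row_free_unit; apply: inj_row_free => v vM.
  have {}vM : M *m v^T = 0 by rewrite -hM -trmx_mul vM trmx0.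
  suff v0 : v^T = 0 by rewrite -(trmxK v) v0 trmx0.
  move: v^T vM => {v} w; rewrite -(vsubmxK w) mul_block_col -[RHS]vsubmxK => /eq_col_mx[].
  rewrite !linear0 mul0mx addr0; move: (usubmx w) (dsubmx w) => d s Qd cd.
  have cd0 : dotv c d = 0 by rewrite /dotv cd mxE.
  have d0 : d = 0.
    apply/eqP/contraT => dn0; have := pdQ d dn0 cd0.
    have -> : Q *m d = - (c *m s) by apply/eqP; rewrite -addr_eq0 Qd.
    by rewrite -scaleN1r dotvZr dotv_mulmx dotv1 cd mxE mul0r mulr0 ltxx.
  move: Qd; rewrite d0 mulmx0 add0r => cs.
  have -> : s = 0; last by rewrite col_mx0.
  apply/matrixP => i j; rewrite !ord1 mxE; apply/eqP/contraT => s0.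
  case/eqP: cn0; apply/matrixP => k l; rewrite !ord1 mxE.
  move/matrixP/(_ k 0): cs; rewrite !mxE big_ord1 => /eqP.
  by rewrite mulf_eq0 (negbTE s0) orbF => /eqP.
pose w := invmx M *m col_mx 0 1 : 'cV[R]_(n + 1).
have Mw : M *m w = col_mx 0 1 by rewrite mulKVmx.
pose e := usubmx w; pose s := dsubmx w 0 0.
have [Qe ce] : Q *m e = - s *: c /\ dotv c e = 1.
  move: Mw; rewrite -(vsubmxK w) mul_block_col => /eq_col_mx[].
  rewrite mul0mx addr0 => Qe ce; split; last by rewrite /dotv ce mxE.
  apply/eqP; rewrite scaleNr -addr_eq0 -[X in _ == X]Qe; apply/eqP; congr (_ + _).
  by apply/matrixP => i j; rewrite !ord1 !mxE big_ord1 mulrC.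
(* From [Q e = - s c] and [c . e = 1] one gets [P e = 0]. So the form of [P] at [d] equals its value
   at [d - (c . d) e], which lies in the kernel of [c], where [P] and [Q] define the same form. *)
pose P := Q + s *: (c *m c^T).
have PE d : dotv d (P *m d) = dotv d (Q *m d) + s * dotv c d ^+ 2.
  rewrite mulmxDl dotvDr -scalemxAl dotvZr -mulmxA (dotv_mulmx c) dotv1.
  have -> : (c^T *m d) 0 0 = dotv c d by [].
  ring.
have hP : P^T = P by rewrite /P linearD/= linearZ/= trmx_mul trmxK hQ.
have psdP d : 0 <= dotv d (P *m d).
  set t := dotv c d.
  have ct : dotv c (d - t *: e) = 0 by rewrite -scaleNr dotvDr dotvZr ce -/t; ring.
  have := psdQ _ ct; rewrite PE.
  rewrite -scaleNr mulmxDr -scalemxAr !(dotvDr, dotvDl, dotvZl, dotvZr).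
  rewrite (dotv_sym e d hQ) Qe !dotvZr (dotvC e) (dotvC d c) ce -/t.
  congr (0 <= _); ring.
have [p [L LE]] := psd_factor hP psdP.
exists (- s), p, L => d; rewrite -LE PE; ring.
Qed.

End QuadraticForm.

(** * Quadratic functions along lines *)

Definition quadf (R : realType) (n : nat) (Q : 'M[R]_n) (alpha x : 'cV[R]_n) : R :=
  dotv x (Q *m x) + dotv alpha x.

Definition grad (R : realType) (n : nat) (Q : 'M[R]_n) (alpha x : 'cV[R]_n) : 'cV[R]_n :=
  2 *: (Q *m x) + alpha.

Section Quadratic.
Context {R : realType} {n : nat}.
Implicit Types (Q : 'M[R]_n) (alpha x d : 'cV[R]_n).

Lemma quadfD Q alpha x d : Q^T = Q ->
  quadf Q alpha (x + d) = quadf Q alpha x + dotv (grad Q alpha x) d + dotv d (Q *m d).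
Proof.
move=> hQ; rewrite /quadf /grad mulmxDr !(dotvDr, dotvDl, dotvZl).
rewrite (dotv_sym d x hQ) (dotvC (Q *m x)) (dotv_sym d x hQ); ring.
Qed.

Lemma quadf_line Q alpha x d t : Q^T = Q ->
  quadf Q alpha (x + t *: d) =
  quadf Q alpha x + t * dotv (grad Q alpha x) d + t ^+ 2 * dotv d (Q *m d).
Proof. by move=> hQ; rewrite quadfD// -scalemxAr !dotvZr dotvZl; ring. Qed.

Lemma quadf_ivt Q alpha g x d : Q^T = Q ->
  quadf Q alpha x <= g -> g <= quadf Q alpha (x + d) ->
  exists2 t, 0 <= t <= 1 & quadf Q alpha (x + t *: d) = g.
Proof.
move=> hQ xg gd.
(* On a line, [quadf - g] is a polynomial in the parameter, so the intermediate value property of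
   polynomials applies. *)
pose p : {poly R} := (quadf Q alpha x - g)%:P + dotv (grad Q alpha x) d *: 'X +
  dotv d (Q *m d) *: 'X^2.
have pE t : p.[t] = quadf Q alpha (x + t *: d) - g.
  by rewrite quadf_line// /p !hornerE /=; ring.
have [||t t01 /rootP] := @poly_ivt _ p 0 1; first exact: ler01.
  by rewrite !pE scale0r addr0 scale1r subr_le0 xg subr_ge0.
by rewrite pE => /eqP; rewrite subr_eq0 => /eqP; exists t.
Qed.

Lemma quadfN Q alpha x : quadf (- Q) (- alpha) x = - quadf Q alpha x.
Proof.
by rewrite /quadf mulNmx -[- (Q *m x)]scaleN1r -[- alpha]scaleN1r dotvZr dotvZl; ring.
Qed.

End Quadratic.

(** * Polyhedra and their faces *)

Section Polyhedron.
Context {R : realType} {l n : nat} (A : 'M[R]_(l, n)) (b : 'cV[R]_l).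
Implicit Types x d : 'cV[R]_n.

Lemma mulmx_dotv i x : (A *m x) i 0 = dotv (row i A)^T x.
Proof. by rewrite /dotv trmxK -row_mul [RHS]mxE. Qed.

Lemma polyhedron_cvx : cvx (polyhedron A b).
Proof.
move=> x y t /andP[t0 t1] Px Py i.
rewrite mulmx_dotv dotvDr !dotvZr -!mulmx_dotv.
have -> : b i 0 = t * b i 0 + (1 - t) * b i 0 by ring.
by rewrite lerD// ler_wpM2l// subr_ge0.
Qed.

Lemma socset_polyhedron : socset (polyhedron A b).
Proof.
exists l, (fun i => SocConstraint (0 : 'M[R]_(0, n)) 0 (-1 *: (row i A)^T) (b i 0)).
apply: eq_set => x; apply: eq_forall => i; rewrite /soc_sat/= norm2E (flatmx0 (_ + _)).
rewrite dotv0l sqrtr0 dotvZl -mulmx_dotv mulN1r addrC subr_ge0.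
by [].
Qed.

(** A zero row with zero right-hand side is tight everywhere; requiring a nonzero row makes the
    tight set lie in a hyperplane. *)
Definition on_face i x : Prop := row i A != 0 /\ (A *m x) i 0 = b i 0.

(** The ratio test of linear programming. Boundedness yields a row increasing along [d]; among such
    rows the one reached first becomes tight, and it is nonzero because it increases along [d]. *)
Lemma polyhedron_exit x d : entry_bounded (polyhedron A b) ->
  polyhedron A b x -> d != 0 -> exists2 t, 0 <= t &
    polyhedron A b (x + t *: d) /\ exists i, on_face i (x + t *: d).
Proof.
move=> bP Px d0.
have lineE i t : (A *m (x + t *: d)) i 0 = (A *m x) i 0 + t * (A *m d) i 0.
  by rewrite mulmxDr -scalemxAr !mxE.
pose up i := 0 < (A *m d) i 0.
have [i0 upi0] : exists i, up i.
  apply/not_existsP => noup; case/eqP: d0; apply: (entry_bounded_ray (x := x) bP) => t t0 i.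
  rewrite lineE; apply: le_trans (Px i); rewrite gerDl mulr_ge0_le0// leNgt.
  exact/negP/noup.
pose f i := (b i 0 - (A *m x) i 0) / (A *m d) i 0.
case: (arg_minP f upi0) => i upi fmin.
have f0 : 0 <= f i by rewrite divr_ge0 ?subr_ge0// ltW.
exists (f i) => //; split; last first.
  exists i; split; last by rewrite lineE /f divfK ?lt0r_neq0// addrC subrK.
  by apply: contraTneq upi => Ai0; rewrite /up mulmx_dotv Ai0 trmx0 dotv0l ltxx.
move=> j; rewrite lineE; have [upj|] := boolP (up j).
  have := fmin j upj; rewrite /(f j) ler_pdivlMr// => ?.
  by rewrite -lerBrDl.
rewrite /up -leNgt => dj; apply: le_trans (Px j).
by rewrite gerDl mulr_ge0_le0.
Qed.

End Polyhedron.

(** * Quadrics positive definite on a tangent hyperplane *)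

(* With [x0] on the quadric, [t] the differential of [quadf] at [x0] and
   [y = L (x - x0)], the constraint reads [|y|^2 + a t^2 + t <= 0]: a convex set
   for [a >= 0], and the two branches [+-(1 + 2 a t) >= sqrt (1 - 4 a |y|^2)]
   otherwise. *)
Lemma socr_hull_quadric_pd (R : realType) (n l : nat) (Q : 'M[R]_n) (alpha : 'cV[R]_n)
    (g : R) (A : 'M[R]_(l, n)) (b : 'cV[R]_l) (x0 : 'cV[R]_n) :
  Q^T = Q -> entry_bounded (polyhedron A b) -> quadf Q alpha x0 = g ->
  (forall d, d != 0 -> dotv (grad Q alpha x0) d = 0 -> 0 < dotv d (Q *m d)) ->
  socr (conv_hull [set x | quadf Q alpha x <= g /\ polyhedron A b x]).
Proof.
move=> hQ bP qx0 /(hyperplane_pd_factor hQ)[a [p [L LE]]].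
set c := grad Q alpha x0 in LE.
pose k (x : 'cV[R]_n) : 'cV[R]_1 := c^T *m (x - x0).
pose y (x : 'cV[R]_n) := L *m (x - x0).
have ak : affine k by apply: affineM; apply: affineB affine_id (affine_cst _).
have ay : affine y by apply: affineM; apply: affineB affine_id (affine_cst _).
have qE x : (quadf Q alpha x <= g) =
    (dotv (y x) (y x) + a * k x 0 0 ^+ 2 + k x 0 0 <= 0).
  have {1}-> : x = x0 + (x - x0) by rewrite addrC subrK.
  rewrite quadfD// qx0 LE -/c -/(dotv c (x - x0)) -/(y x) -subr_le0.
  by congr (_ <= 0); rewrite /k -/(dotv c (x - x0)); ring.
have sP := socset_polyhedron A b.
have [a0|a0] := leP 0 a.
  suff sS : socr [set x | quadf Q alpha x <= g /\ polyhedron A b x].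
    by rewrite conv_hull_id//; exact: socr_cvx.
  apply: socr_soc; apply: (@socsetI _ _ [set x | quadf Q alpha x <= g]) => //.
  (* Since [(1 - t)^2 - (1 + t)^2 = - 4 t], four times the inequality reads [4 |y|^2 + (1 + t)^2 + 4
     a t^2 <= (1 - t)^2]; it also forces [t <= 0], hence [1 - t >= 0]. *)
  have -> : [set x | quadf Q alpha x <= g] = [set x | norm2 (col_mx (2 *: y x)
      (col_mx (1 + k x) ((2 * Num.sqrt a) *: k x))) <= (1 - k x) 0 0].
    apply: eq_set => x; rewrite qE; apply/propext; rewrite norm2_le !dotv_col !dotv1.
    rewrite dotvZl dotvZr; move: (k x) (dotv_ge0 (y x)) => t; rewrite !mxE eqxx mulr1n.
    move: (t 0 0) (dotv (y x) (y x)) => {}t u u0.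
    have -> : 2 * Num.sqrt a * t * (2 * Num.sqrt a * t) = 4 * Num.sqrt a ^+ 2 * t ^+ 2 by ring.
    have at0 : 0 <= a * t ^+ 2 by rewrite mulr_ge0// sqr_ge0.
    by rewrite sqr_sqrtr//; split=> [ut|[t1 ut]]; [split|]; lra.
  apply: socset_soc; last exact: affineB (affine_cst _) ak.
  apply: affine_col (affineZ _ ay) (affine_col _ (affineZ _ ak)).
  exact: affineD (affine_cst _) ak.
pose S (s : R) := [set x | norm2 (col_mx ((2 * Num.sqrt (- a)) *: y x) (1 : 'cV[R]_1)) <=
   (s *: (1 + (2 * a) *: k x)) 0 0].
have sS s : socr (S s `&` polyhedron A b).
  apply: socr_soc; apply: socsetI sP; apply: socset_soc.
    exact: affine_col (affineZ _ ay) (affine_cst _).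
  by apply: affineZ; apply: affineD (affine_cst _) (affineZ _ ak).
have -> : [set x | quadf Q alpha x <= g /\ polyhedron A b x] =
    (S 1 `&` polyhedron A b) `|` (S (-1) `&` polyhedron A b).
  rewrite -setIUl; congr (_ `&` _); apply/seteqP; rewrite /S.
  suff e x : quadf Q alpha x <= g <-> (S 1 `|` S (-1)) x by split=> x /e.
  rewrite qE /S/= !norm2_le !dotv_col !dotv1 dotvZl dotvZr.
  move: (k x) (dotv_ge0 (y x)) => t; rewrite !mxE eqxx mulr1n.
  move: (t 0 0) (dotv (y x) (y x)) => {}t u u0.
  have -> : 2 * Num.sqrt (- a) * (2 * Num.sqrt (- a) * u) =
    4 * Num.sqrt (- a) ^+ 2 * u by ring.
  rewrite sqr_sqrtr; last by rewrite oppr_ge0 ltW.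
  (* Multiplication by [4 a < 0] reverses the inequality and completes the square in [t]; the sign
     of [1 + 2 a t] then selects the branch. *)
  have -> : (u + a * t ^+ 2 + t <= 0) = (4 * - a * u + 1 * 1 <= (1 + 2 * a * t) ^+ 2).
    rewrite -(@ler_nM2l _ (4 * a)) ?mulr0; last by lra.
    by apply/idP/idP; lra.
  split; last by move=> [|] [_]; lra.
  by case: (leP 0 (1 + 2 * a * t)) => h ut; [left|right]; split; lra.
by apply: socr_hullU => //; apply: entry_bounded_sub bP => x [].
Qed.

(** * Restriction to facets *)

(** The equation is solved for a coordinate [j] with [c j] nonzero. The other coordinates are the
    parameters themselves, so that coordinate bounds carry over to them. *)
Lemma hyperplane_param (R : realType) (n : nat) (c : 'cV[R]_n.+1) (beta : R) :
  c != 0 -> exists h : 'cV[R]_n -> 'cV[R]_n.+1,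
    [/\ affine h, forall x, (exists y, h y = x) <-> dotv c x = beta &
      exists j, forall y k, h y (lift j k) 0 = y k 0].
Proof.
move=> c0; have [j cj] : exists j, c j 0 != 0.
  apply/not_existsP => c_0; case/eqP: c0; apply/matrixP => i k.
  by rewrite ord1 mxE; apply/eqP/contraT => ci; case: (c_0 i).
pose N : 'M[R]_(n.+1, n) := \matrix_(i, k)
  if unlift j i is Some i' then (i' == k)%:R else - (c (lift j k) 0 / c j 0).
pose h (y : 'cV[R]_n) := N *m y + (beta / c j 0) *: delta_mx j 0.
have hl y k : h y (lift j k) 0 = y k 0.
  rewrite !mxE [_ == j]eq_sym (negbTE (neq_lift j k)) mulr0 addr0.
  rewrite (bigD1 k)//= mxE liftK eqxx mul1r.
  rewrite big1 ?addr0// => i ik; rewrite mxE liftK eq_sym (negbTE ik) mul0r//.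
have hj y : h y j 0 = (beta - \sum_k c (lift j k) 0 * y k 0) / c j 0.
  rewrite !mxE !eqxx mulr1 mulrBl addrC; congr (_ + _).
  rewrite mulr_suml -sumrN; apply: eq_bigr => k _.
  by rewrite mxE unlift_none mulNr mulrAC.
exists h; split; last by exists j.
  by exists N, ((beta / c j 0) *: delta_mx j 0).
have dE x : dotv c x = c j 0 * x j 0 + \sum_k c (lift j k) 0 * x (lift j k) 0.
  by rewrite dotvE (bigD1_ord j).
move=> x; split=> [[y <-]|cx].
  rewrite dE hj mulrC divfK//; under [X in _ + X]eq_bigr do rewrite hl.
  by rewrite subrK.
exists (\col_k x (lift j k) 0); apply/matrixP => i k; rewrite ord1.
case: (unliftP j i) => [i' ->|->]; first by rewrite hl mxE.
rewrite hj -cx dE; under [X in _ - X]eq_bigr do rewrite mxE.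
by rewrite addrK mulrAC divff// mul1r.
Qed.

Section Main.
Context {R : realType}.

(** Taylor expansion at [v]; the constant is kept apart so that it can be absorbed into the
    level. *)
Lemma quadf_affine n m (Q : 'M[R]_n) alpha (M : 'M[R]_(n, m)) v : Q^T = Q ->
  exists Q' alpha', Q'^T = Q' /\
    forall y, quadf Q alpha (M *m y + v) = quadf Q alpha v + quadf Q' alpha' y.
Proof.
move=> hQ; exists (M^T *m Q *m M), (M^T *m grad Q alpha v); split.
  by rewrite !trmx_mul trmxK hQ mulmxA.
move=> y; rewrite addrC quadfD// /quadf -!mulmxA.
rewrite (dotv_mulmx M^T) trmxK -(dotv_mulmx M); ring.
Qed.

(** The first hypothesis is the induction hypothesis one dimension lower. A facet is the affine
    image of a polytope in that dimension, on which the function is again quadratic. *)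
Lemma socr_hull_face n l (Q : 'M[R]_n.+1) alpha g (A : 'M[R]_(l, n.+1)) b (i : 'I_l) :
  (forall (Q : 'M[R]_n) alpha g (A : 'M[R]_(l, n)) b, Q^T = Q ->
    entry_bounded (polyhedron A b) ->
    socr (conv_hull [set x | quadf Q alpha x <= g /\ polyhedron A b x])) ->
  Q^T = Q -> entry_bounded (polyhedron A b) ->
  socr (conv_hull [set x | (quadf Q alpha x <= g /\ polyhedron A b x) /\ on_face A b i x]).
Proof.
move=> IHn hQ [M PM]; have [Ai0|Ai0] := eqVneq (row i A) 0.
  rewrite conv_hull_id; last by move=> x y t _ [_ []]; rewrite Ai0 eqxx.
  suff -> : [set x | (quadf Q alpha x <= g /\ polyhedron A b x) /\ on_face A b i x] = set0.
    exact: socr0.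
  by apply/seteqP; split=> // x [_ []]; rewrite Ai0 eqxx.
have Ai0T : (row i A)^T != 0.
  by apply: contraNneq Ai0 => h; rewrite -(trmxK (row i A)) h trmx0.
have [h [ah hP [j hj]]] := hyperplane_param (b i 0) Ai0T.
have [N [v hE]] := ah.
have [Q' [alpha' [hQ' QE]]] := quadf_affine alpha N v hQ.
have PE y : polyhedron (A *m N) (b - A *m v) y <-> polyhedron A b (h y).
  have e k : ((A *m N *m y) k 0 <= (b - A *m v) k 0) = ((A *m h y) k 0 <= b k 0).
    rewrite hE mulmxDr mulmxA; move: (A *m N *m y) (A *m v) => p q.
    by rewrite !mxE lerBrDr.
  by split=> Py k; have := Py k; rewrite e.
have -> : [set x | (quadf Q alpha x <= g /\ polyhedron A b x) /\ on_face A b i x] =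
    [set h y | y in [set y | quadf Q' alpha' y <= g - quadf Q alpha v /\
                             polyhedron (A *m N) (b - A *m v) y]].
  apply/seteqP; split=> [x [[xg Px] [_]]|_ [y [yg /PE Py] <-]].
    rewrite mulmx_dotv => /hP[y yE]; exists y => //; split.
      by rewrite lerBrDl -QE -hE yE.
    by apply/PE; rewrite yE.
  split; first by split=> //; rewrite hE QE -lerBrDl.
  by split=> //; rewrite mulmx_dotv; apply/hP; exists y.
rewrite conv_hull_affine//; apply: socr_affine_image => //; apply: IHn => //.
by exists M => y /PE/PM yM k; rewrite -(hj y k).
Qed.

(** * Sublevel hulls by induction on the dimension *)

(* The condition on [d] says that moving along [d] in both directions never leaves
   [quadf <= g]. *)
Lemma sublevel_hull_faces n l (Q : 'M[R]_n.+1) alpha g (A : 'M[R]_(l, n.+1)) b :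
  Q^T = Q -> entry_bounded (polyhedron A b) ->
  (forall x, quadf Q alpha x = g -> exists d,
     [/\ d != 0, dotv (grad Q alpha x) d = 0 & dotv d (Q *m d) <= 0]) ->
  [set x | quadf Q alpha x <= g /\ polyhedron A b x] `<=`
  conv_hull [set x | exists2 i, i \in enum 'I_l &
    (quadf Q alpha x <= g /\ polyhedron A b x) /\ on_face A b i x].
Proof.
move=> hQ bP flat; set F := [set x | exists2 i, _ & _].
have FE x i : quadf Q alpha x <= g -> polyhedron A b x -> on_face A b i x -> F x.
  by move=> ? ? ?; exists i; rewrite ?mem_enum.
(* A point on the quadric lies between the two points where its flat line leaves the polytope, and
   both are on facets and in the sublevel set. *)
have level x : quadf Q alpha x = g -> polyhedron A b x -> conv_hull F x.
  move=> xg Px; have [d [d0 gd dQd]] := flat x xg.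
  have along t : quadf Q alpha (x + t *: d) <= g.
    by rewrite quadf_line// gd xg mulr0 addr0 gerDl mulr_ge0_le0// sqr_ge0.
  have [s s0 [Ps [i Fi]]] := polyhedron_exit bP Px d0.
  have [|t t0 [Pt [k Fk]]] := polyhedron_exit bP Px (d := - d); first by rewrite oppr_eq0.
  apply: (cvx_opposite (d := d) (@conv_hull_cvx _ _ F) s0 t0).
    by apply: sub_conv_hull; apply: FE Fi.
  apply: sub_conv_hull; rewrite scalerN in Pt Fk.
  by apply: FE Fk => //; rewrite -scaleNr.
move=> x [xg Px].
(* Every ray from [x] meets the hull: either its exit point from the polytope is still in the
   sublevel set, or the ray crosses the quadric before, at a point settled by [level]. *)
have ray d : d != 0 -> exists2 t, 0 <= t & conv_hull F (x + t *: d).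
  move=> d0; have [t t0 [Pt [i Fi]]] := polyhedron_exit bP Px d0.
  have [tg|/ltW tg] := leP (quadf Q alpha (x + t *: d)) g.
    by exists t => //; apply: sub_conv_hull; apply: FE Fi.
  have [s /andP[s0 s1] sg] := quadf_ivt hQ xg tg.
  rewrite scalerA in sg; exists (s * t); first by rewrite mulr_ge0.
  apply: level => //.
  have -> : x + (s * t) *: d = s *: (x + t *: d) + (1 - s) *: x.
    by apply/matrixP => i' j'; rewrite !mxE; ring.
  by apply: polyhedron_cvx => //; rewrite s0.
(* Any nonzero direction would serve here; its two opposite rays enclose [x]. *)
have d0 : delta_mx 0 0 != 0 :> 'cV[R]_n.+1.
  by apply/eqP => /matrixP/(_ 0 0); rewrite !mxE !eqxx => /eqP; rewrite oner_eq0.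
have [s s0 Fs] := ray _ d0.
have [|t t0 Ft] := ray (- delta_mx 0 0); first by rewrite oppr_eq0.
rewrite scalerN in Ft; exact: (cvx_opposite (@conv_hull_cvx _ _ F) s0 t0 Fs Ft).
Qed.

Lemma socr_hull_sublevel n l (Q : 'M[R]_n) alpha g (A : 'M[R]_(l, n)) b :
  Q^T = Q -> entry_bounded (polyhedron A b) ->
  socr (conv_hull [set x | quadf Q alpha x <= g /\ polyhedron A b x]).
Proof.
elim: n => [|n IHn] in Q alpha g A b *.
  (* The space has a single point in dimension zero, so the hull is empty or everything. *)
  move=> _ _; set C := conv_hull _.
  have CE x : C x = C 0 by rewrite (flatmx0 x).
  apply: socr_soc; have [C0|nC0] := pselect (C 0).
    have -> : C = setT by apply/seteqP; split=> // x _; rewrite CE.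
    exact: socsetT.
  have -> : C = [set x | 0 <= (-1 : 'cV[R]_1) 0 0].
    by apply/seteqP; split=> x /=; rewrite CE// !mxE eqxx oppr_ge0 ler10.
  exact: socset_ge0 (affine_cst _).
move=> hQ bP.
(* If flat directions do not exist everywhere, some [x0] on the quadric has none, which says that
   [Q] is positive definite on the kernel of the gradient at [x0]. *)
have [flat|/existsNP[x0 /not_implyP[qx0 nflat]]] := pselect (forall x,
  quadf Q alpha x = g -> exists d,
     [/\ d != 0, dotv (grad Q alpha x) d = 0 & dotv d (Q *m d) <= 0]); last first.
  apply: (socr_hull_quadric_pd hQ bP qx0) => d d0 gd.
  by rewrite ltNge; apply/negP => dQd; apply: nflat; exists d.
rewrite (conv_hull_absorb _ (sublevel_hull_faces hQ bP flat)); last by move=> x [i _ []].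
have := @socr_hull_finU _ _ _ (enum 'I_l) (fun i => [set x |
  (quadf Q alpha x <= g /\ polyhedron A b x) /\ on_face A b i x])
  _ (@polyhedron_cvx _ _ _ A b) bP.
apply => [i x [[]]//|i].
exact: socr_hull_face.
Qed.

(** * Level sets as intersections of two hulls *)

(* The segments from [x] to the points of [G] all cross [C]; the points [y] whose
   segment from [x] meets [C] away from [x] form a convex set, hence contain [x]. *)
Lemma cvx_star n (C G : set 'cV[R]_n) x : cvx C -> conv_hull G x ->
  (forall y, G y -> exists2 t, 0 < t <= 1 & C (x + t *: (y - x))) -> C x.
Proof.
move=> cC Gx Gt.
pose K := [set y | exists2 t, 0 < t <= 1 & C (x + t *: (y - x))].
suff cK : cvx K.
  by have [t _] := conv_hull_min cK Gt Gx; rewrite subrr scaler0 addr0.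
move=> y z m m01 [s /andP[s0 s1] Cs] [t /andP[t0 t1] Ct].
have [m0 m1] := andP m01.
have D0 : 0 < m * t + (1 - m) * s.
  have [->|mn0] := eqVneq m 0; first by rewrite mul0r add0r subr0 mul1r.
  rewrite ltr_pwDl ?mulr_ge0 ?subr_ge0 ?(ltW s0)// mulr_gt0//.
  by rewrite lt_neqAle eq_sym mn0.
(* The two points of [C] are combined with weights proportional to [m t] and [(1 - m) s], so that
   [y] and [z] enter in the ratio [m : 1 - m]. Positivity of [s] and [t] keeps the denominator
   nonzero. *)
exists (s * t / (m * t + (1 - m) * s)).
  rewrite divr_gt0 ?mulr_gt0//= ler_pdivrMr// mul1r.
  have -> : s * t = m * (s * t) + (1 - m) * (s * t) by ring.
  rewrite lerD// ler_wpM2l ?subr_ge0//; first by rewrite ler_piMl// ltW.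
  by rewrite ler_piMr// ltW.
have := cC _ _ (m * t / (m * t + (1 - m) * s)) _ Cs Ct.
have -> : (m * t / (m * t + (1 - m) * s)) *: (x + s *: (y - x)) +
    (1 - m * t / (m * t + (1 - m) * s)) *: (x + t *: (z - x)) =
    x + (s * t / (m * t + (1 - m) * s)) *: (m *: y + (1 - m) *: z - x).
  by apply/matrixP => i j; rewrite !mxE; field; rewrite lt0r_neq0.
apply; rewrite divr_ge0 ?mulr_ge0 ?(ltW t0) ?(ltW D0)//=.
by rewrite ler_pdivrMr// mul1r lerDl mulr_ge0 ?subr_ge0// ltW.
Qed.

(** A point of both hulls off the level set lies strictly on one side of it; the hull of the
    opposite side then supplies the set [G] of [cvx_star]. *)
Lemma conv_hull_level n l (Q : 'M[R]_n) alpha g (A : 'M[R]_(l, n)) b : Q^T = Q ->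
  conv_hull [set x | quadf Q alpha x = g /\ polyhedron A b x] =
  conv_hull [set x | quadf Q alpha x <= g /\ polyhedron A b x] `&`
  conv_hull [set x | g <= quadf Q alpha x /\ polyhedron A b x].
Proof.
move=> hQ; apply/seteqP; split.
  by rewrite subsetI; split; apply: conv_hull_mono => x /= [-> Px]; split.
move=> x [xle xge].
have Px : polyhedron A b x.
  by apply: conv_hull_min xle => [|y []//]; exact: polyhedron_cvx.
have cS := @conv_hull_cvx _ _ [set x | quadf Q alpha x = g /\ polyhedron A b x].
(* Stated for an arbitrary quadratic function so that it applies to the negated one as well.
   Strictness at [x] excludes the crossing parameter [t = 0]. *)
have meet Q1 alpha1 g1 y : Q1^T = Q1 -> quadf Q1 alpha1 x < g1 ->
    g1 <= quadf Q1 alpha1 y -> polyhedron A b y ->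
    exists2 t, 0 < t <= 1 & quadf Q1 alpha1 (x + t *: (y - x)) = g1 /\
      polyhedron A b (x + t *: (y - x)).
  move=> hQ1 xg yg Py.
  have [|t /andP[t0 t1] tg] := quadf_ivt hQ1 (ltW xg) (d := y - x).
    by rewrite addrC subrK.
  exists t.
    rewrite t1 andbT lt_neqAle t0 andbT eq_sym; apply: contraTneq xg => t_0.
    by rewrite -tg t_0 scale0r addr0 ltxx.
  split=> //; have -> : x + t *: (y - x) = t *: y + (1 - t) *: x.
    by apply/matrixP => i j; rewrite !mxE; ring.
  by apply: polyhedron_cvx => //; rewrite t0.
have [xg|xg|xg] := ltgtP (quadf Q alpha x) g; last by apply: sub_conv_hull.
  apply: cvx_star cS xge _ => y [yg Py].
  have [t t01 Ht] := meet _ _ _ _ hQ xg yg Py.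
  by exists t => //; apply: sub_conv_hull.
apply: cvx_star cS xle _ => y [yg Py].
have [|||t t01 [Ht Pt]] := meet (- Q) (- alpha) (- g) y _ _ _ Py.
- by rewrite linearN/= hQ.
- by rewrite quadfN ltrN2.
- by rewrite quadfN lerN2.
exists t => //; apply: sub_conv_hull; split=> //.
by apply: oppr_inj; rewrite -quadfN.
Qed.

End Main.

Theorem theorem1 (R : realType) (n : nat) (hn : (1 <= n)%N)
    (Q : 'M[R]_n) (hQ : Q^T = Q) (alpha : 'cV[R]_n) (g : R)
    (l : nat) (A : 'M[R]_(l, n)) (b : 'cV[R]_l)
    (hP : bounded_set (polyhedron A b)) :
  socr (conv_hull [set x : 'cV[R]_n |
    (x^T *m Q *m x) ord0 ord0 + dotv alpha x = g /\ polyhedron A b x]).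
Proof.
have bP := bounded_set_entry hP.
have -> : [set x : 'cV[R]_n | (x^T *m Q *m x) ord0 ord0 + dotv alpha x = g /\
    polyhedron A b x] = [set x | quadf Q alpha x = g /\ polyhedron A b x].
  by apply: eq_set => x; rewrite /quadf /dotv mulmxA.
rewrite conv_hull_level//; apply: socrI; first exact: socr_hull_sublevel.
(* The superlevel set is a sublevel set of the negated function; no definiteness is assumed of [Q],
   so the same result covers it. *)
have -> : [set x | g <= quadf Q alpha x /\ polyhedron A b x] =
    [set x | quadf (- Q) (- alpha) x <= - g /\ polyhedron A b x].
  by apply: eq_set => x; rewrite quadfN lerN2.
by apply: socr_hull_sublevel => //; rewrite linearN/= hQ.
Qed.
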